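(* Let $f=\frac1n\sum_{i=1}^n f_i$ be an $L$-smooth, $\mu$-strongly convex quadratic finite sum as described in the context, with $n\ge2$, $\kappa=L/\mu$ and minimizer $w^*$. Let $0<a\le 1$ be a constant and run stochastic heavy ball $$w_{k+1}=w_k-\alpha\nabla f_{ik}(w_k)+\beta(w_k-w_{k-1}),\qquad w_{-1}=w_0,$$ with $\alpha=\frac{a}{L}$, $\beta=\left(1-\frac12\sqrt{\alpha\mu}\right)^2$ and batch-size $b$ such that $$b\ge b^*:=n\,\max\left\{\frac{1}{1+\frac{n-1}{C\kappa^2}},\ \frac{1}{1+\frac{(n-1)a}{3}}\right\},\qquad C:=3^5 2^6 .$$ Then for every $T\ge1$, $$\mathbb{E}\|w_T-w^*\|\le\frac{6\sqrt2\sqrt\kappa}{\sqrt a}\exp\left(-\frac{\sqrt a\,T}{2\sqrt\kappa}\max\left\{\frac34,\ 1-2\sqrt\kappa\sqrt\zeta\right\}\right)\|w_0-w^*\|+\frac{12\sqrt a\,\chi}{\mu}\min\left\{1,\frac{\zeta}{\sqrt a}\right\},$$ where $\chi:=\sqrt{\frac1n\sum_{i=1}^n\|\nabla f_i(w^* )\|^2}$ and $\zeta=\sqrt{3\,\frac{n-b}{(n-1)b}}$.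
   Context: Setting: $f_i(w)=\frac12 w^TA_iw-\langle d_i,w\rangle$ on $\mathbb{R}^d$ with $A_i$ symmetric positive semi-definite and each $f_i$ bounded below; $f=\frac1n\sum_i f_i=\frac12 w^TAw-\langle d,w\rangle$ with $A=\frac1n\sum_iA_i$, $d=\frac1n\sum_i d_i$. Each $f_i$ is $L$-smooth with $L=\max_i\lambda_{\max}(A_i)$, and $\mu=\lambda_{\min}(A)>0$. At each iteration $k$ a mini-batch $B_k\subseteq\{1,\dots,n\}$ of size $b$ is sampled uniformly without replacement, independently across iterations, and $\nabla f_{ik}(w):=\frac1b\sum_{i\in B_k}\nabla f_i(w)$. $\mathbb{E}$ is over all mini-batches; $\|\cdot\|$ is the Euclidean norm. *)

(* Defs.v *)
From HB Require Import structures.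
From mathcomp Require Import all_boot all_order all_algebra.
From mathcomp Require Import all_classical all_reals all_analysis.

Set Implicit Arguments.
Unset Strict Implicit.
Unset Printing Implicit Defensive.

Import Order.TTheory GRing.Theory Num.Theory.
Import numFieldNormedType.Exports.

Local Open Scope classical_set_scope.
Local Open Scope ring_scope.

(* The norm `|v| of a matrix in the library is the sup norm. *)
Definition enorm (R : realType) (d : nat) (v : 'cV[R]_d) : R :=
  Num.sqrt (\sum_(i < d) v i 0 ^+ 2).

Definition quad_fun (R : realType) (d : nat) (A : 'M[R]_d) (c w : 'cV[R]_d) : R :=
  2^-1 * (w^T *m A *m w) 0 0 - (c^T *m w) 0 0.

Definition sym_psd (R : realType) (d : nat) (A : 'M[R]_d) : Prop :=
  A^T = A /\ forall v : 'cV[R]_d, 0 <= (v^T *m A *m v) 0 0.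

Definition bounded_below (T : Type) (R : realType) (f : T -> R) : Prop :=
  exists m : R, forall w, m <= f w.

Definition gradient (R : realType) (d : nat) (f : 'cV[R]_d -> R) (w : 'cV[R]_d)
    : 'cV[R]_d :=
  \col_(j < d) 'D_(delta_mx j 0) f w.

(* The spectrum is finite, and nonempty for a symmetric matrix of positive size;
   the supremum and the infimum are then attained.  Both are 0 for size 0. *)
Definition lambda_max (R : realType) (d : nat) (A : 'M[R]_d) : R :=
  sup [set x : R | eigenvalue A x].

Definition lambda_min (R : realType) (d : nat) (A : 'M[R]_d) : R :=
  inf [set x : R | eigenvalue A x].

(* The default value 0 of the iterated maximum is harmless: the matrices are
   positive semi-definite, so their eigenvalues are nonnegative. *)
Definition smoothness (R : realType) (d n : nat) (A : 'I_n -> 'M[R]_d) : R :=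
  \big[Num.max/0]_(i < n) lambda_max (A i).

Definition batch_gradient (R : realType) (d n b : nat)
    (f : 'I_n -> 'cV[R]_d -> R) (S : {set 'I_n}) (w : 'cV[R]_d) : 'cV[R]_d :=
  b%:R^-1 *: \sum_(i in S) gradient (f i) w.

(* The pair (w_k, w_{k-1}), with w_{-1} = w_0; [g k] is the gradient oracle used
   in the step from w_k to w_{k+1}. *)
Fixpoint heavy_ball_pair (R : realType) (d : nat)
    (g : nat -> 'cV[R]_d -> 'cV[R]_d) (alpha beta : R) (w0 : 'cV[R]_d) (k : nat)
    : 'cV[R]_d * 'cV[R]_d :=
  match k with
  | 0%N => (w0, w0)
  | j.+1 =>
      let p := heavy_ball_pair g alpha beta w0 j in
      (p.1 - alpha *: g j p.1 + beta *: (p.1 - p.2), p.1)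
  end.

Definition heavy_ball (R : realType) (d : nat)
    (g : nat -> 'cV[R]_d -> 'cV[R]_d) (alpha beta : R) (w0 : 'cV[R]_d) (k : nat)
    : 'cV[R]_d :=
  (heavy_ball_pair g alpha beta w0 k).1.

Section Sampling.
Context (disp : measure_display) (Omega : measurableType disp) (R : realType)
  (P : probability Omega R).

Definition mutually_independent (S : finType) (X : nat -> Omega -> S) : Prop :=
  forall (J : seq nat) (E : nat -> set S), uniq J ->
    P (\bigcap_(k in [set` J]) (X k @^-1` E k)) =
    (\prod_(k <- J) P (X k @^-1` E k))%E.

(* Uniform sampling without replacement of [b] indices out of [n]: every subset
   of cardinality [b] has probability 1 / 'C(n, b), and the others are null. *)
Definition uniform_batch (n b : nat) (B : Omega -> {set 'I_n}) : Prop :=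
  forall S : {set 'I_n},
    measurable (B @^-1` [set S]) /\
    P (B @^-1` [set S]) = (if #|S| == b then 'C(n, b)%:R^-1 else 0)%:E.

End Sampling.

(* Main.v *)
Require Import Defs.
From HB Require Import structures.
From mathcomp Require Import all_boot all_order all_algebra.
From mathcomp Require Import all_classical all_reals all_analysis.
From mathcomp Require Import measurable_realfun.
From mathcomp Require Import ring lra.
Import Order.TTheory GRing.Theory Num.Theory.
Import numFieldNormedType.Exports.
Local Open Scope classical_set_scope.
Local Open Scope ring_scope.

(** With [x_k = w_k - w*], [X = alpha A] and [s = sqrt (alpha mu)], heavy ball reads
    [x_(k+1) = M x_k - beta x_(k-1) - alpha delta_k], where [M = (1 + beta) I - X]
    and [delta_k] is the error of the mini-batch gradient.  The quadratic form
    [V (x, y) = <x, x> - <M x, y> + beta <y, y>] is multiplied by exactly [beta]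
    when [delta_k = 0].  As [s^2 I <= X <= I], it is nonnegative and
    [V (x, y) >= (s^2 / 9) |x|^2], so [N = sqrt V] replaces the eigenvalue analysis
    of the iteration: [N_(k+1) <= (1 - s / 2) N_k + alpha |delta_k|].  Given the
    past, sampling without replacement yields
    [E |delta_k| <= zeta (L |x_k| + chi)], so [E N_k] satisfies an affine
    recursion with rate [1 - s / 2 + 3 a zeta / s], which the batch-size condition
    bounds by [1 - (s / 2) max (3 / 4, 1 - 2 sqrt (kappa zeta))]. *)

Set Implicit Arguments.
Unset Strict Implicit.
Unset Printing Implicit Defensive.

(** * Euclidean inner product and positive semi-definite forms *)

Section InnerProduct.
Context (R : realType) (d : nat).
Implicit Types (x y z : 'cV[R]_d) (A : 'M[R]_d) (k : R).

Definition dot x y : R := \sum_i x i 0 * y i 0.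

Lemma dotC x y : dot x y = dot y x.
Proof. by apply: eq_bigr => i _; rewrite mulrC. Qed.

Lemma dotDl x y z : dot (x + y) z = dot x z + dot y z.
Proof. by rewrite -big_split; apply: eq_bigr => i _; rewrite mxE mulrDl. Qed.

Lemma dotZl k x y : dot (k *: x) y = k * dot x y.
Proof. by rewrite mulr_sumr; apply: eq_bigr => i _; rewrite mxE mulrA. Qed.

Lemma dotNl x y : dot (- x) y = - dot x y.
Proof. by rewrite -scaleN1r dotZl mulN1r. Qed.

Lemma dotDr x y z : dot x (y + z) = dot x y + dot x z.
Proof. by rewrite dotC dotDl !(dotC _ x). Qed.

Lemma dotZr k x y : dot x (k *: y) = k * dot x y.
Proof. by rewrite dotC dotZl dotC. Qed.

Lemma dotNr x y : dot x (- y) = - dot x y.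
Proof. by rewrite dotC dotNl dotC. Qed.

Lemma dot0l x : dot 0 x = 0.
Proof. by rewrite -(scale0r 0) dotZl mul0r. Qed.

Definition dotE := (dotDl, dotDr, dotNl, dotNr, dotZl, dotZr).

Lemma dot_suml (I : Type) (s : seq I) (Q : pred I) (f : I -> 'cV[R]_d) x :
  dot (\sum_(i <- s | Q i) f i) x = \sum_(i <- s | Q i) dot (f i) x.
Proof.
elim/big_rec2: _ => [|i y1 y2 _ IH]; first exact: dot0l.
by rewrite dotDl IH.
Qed.

Lemma dot_ge0 x : 0 <= dot x x.
Proof. by apply: sumr_ge0 => i _; rewrite -expr2 sqr_ge0. Qed.

Lemma dot_eq0 x : (dot x x == 0) = (x == 0).
Proof.
rewrite psumr_eq0 => [|i _]; last by rewrite -expr2 sqr_ge0.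
apply/allP/eqP => [h|-> i _]; last by rewrite mxE mul0r eqxx.
apply/colP => i; rewrite mxE.
by have /eqP := h i (mem_index_enum _); move/eqP; rewrite mulf_eq0 orbb => /eqP.
Qed.

Lemma mx_dot x y : (x^T *m y) 0 0 = dot x y.
Proof. by rewrite mxE; apply: eq_bigr => i _; rewrite mxE. Qed.

Lemma mx_quad A x y : (x^T *m A *m y) 0 0 = dot x (A *m y).
Proof. by rewrite -mulmxA mx_dot. Qed.

Lemma dot_mulmx A x y : dot (A *m x) y = dot x (A^T *m y).
Proof. by rewrite -!mx_dot trmx_mul mulmxA. Qed.

Lemma dot_sym A x y : A^T = A -> dot (A *m x) y = dot x (A *m y).
Proof. by rewrite dot_mulmx => ->. Qed.

Lemma enormE x : enorm x = Num.sqrt (dot x x).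
Proof. by rewrite /enorm; congr Num.sqrt; apply: eq_bigr => i _; rewrite expr2. Qed.

Lemma enorm_ge0 x : 0 <= enorm x.
Proof. exact: sqrtr_ge0. Qed.

Lemma enorm_sqr x : enorm x ^+ 2 = dot x x.
Proof. by rewrite enormE sqr_sqrtr ?dot_ge0. Qed.

Lemma enormN x : enorm (- x) = enorm x.
Proof. by rewrite !enormE dotNl dotNr opprK. Qed.

(** Cauchy-Schwarz: the squared norm of [<y, y> x - <x, y> y] is [<y, y>] times the difference of
    the two sides. *)
Lemma dot_sqr_le x y : dot x y ^+ 2 <= dot x x * dot y y.
Proof.
have := dot_ge0 y; rewrite le_eqVlt => /orP[|y0].
  rewrite eq_sym dot_eq0 => /eqP ->.
  by rewrite dotC !dot0l mulr0 expr0n.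
have := dot_ge0 (dot y y *: x - dot x y *: y).
rewrite !dotE (dotC y x) => h.
have {h}: 0 <= dot y y * (dot x x * dot y y - dot x y ^+ 2) by nra.
by rewrite pmulr_rge0 // subr_ge0.
Qed.

Lemma dot_le_enorm x y : dot x y <= enorm x * enorm y.
Proof.
apply: (le_trans (ler_norm _)).
rewrite -(@ler_pXn2r _ 2) ?nnegrE ?normr_ge0 ?mulr_ge0 ?enorm_ge0 //.
by rewrite real_normK ?num_real // exprMn !enorm_sqr dot_sqr_le.
Qed.

Lemma dot_scaleB_sqr k x y : dot (k *: x - y) (k *: x - y) =
  k ^+ 2 * dot x x - 2 * k * dot x y + dot y y.
Proof. by rewrite !dotE (dotC y x); ring. Qed.

Lemma dotD_sqr_le x y : dot (x + y) (x + y) <= 2 * dot x x + 2 * dot y y.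
Proof.
have := dot_ge0 (x - y); rewrite !dotE (dotC y x) => h; lra.
Qed.

Lemma mulmx_bound A : exists2 K, 0 < K & forall x, dot (A *m x) (A *m x) <= K * dot x x.
Proof.
pose r i : 'cV[R]_d := (row i A)^T.
(* The sum is the squared Frobenius norm; the summand 1 keeps the constant positive when [A = 0]. *)
exists (1 + \sum_i dot (r i) (r i)).
  by rewrite ltr_pwDl ?ltr01 // sumr_ge0 // => i _; exact: dot_ge0.
move=> x; rewrite mulrDl mul1r -[leLHS]add0r lerD ?dot_ge0 //.
rewrite mulr_suml; apply: ler_sum => i _.
rewrite -expr2 (_ : (A *m x) i 0 = dot (r i) x) ?dot_sqr_le //.
by rewrite mxE; apply: eq_bigr => j _; rewrite !mxE.
Qed.

Lemma sym_psdP A : sym_psd A <-> A^T = A /\ forall x, 0 <= dot x (A *m x).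
Proof.
by split=> -[sA pA]; split=> // x; have := pA x; rewrite mx_quad.
Qed.

(* Expand [0 <= <A (x - t A x), x - t A x>] with [t = 1 / k]. *)
Lemma psd_sqr_le A k : sym_psd A -> 0 < k ->
  (forall x, dot x (A *m x) <= k * dot x x) ->
  forall x, dot (A *m x) (A *m x) <= k * dot x (A *m x).
Proof.
move=> /sym_psdP[sA pA] k0 Ak x.
have := pA (x - k^-1 *: (A *m x)).
rewrite mulmxBr -scalemxAr !dotE -(dot_sym x (A *m x) sA).
have := Ak (A *m x).
set p := dot (A *m x) (A *m _); set q := dot (A *m x) (A *m x).
set m := dot x _ => h1 h2.
have h3 : k^-1 * k^-1 * p <= k^-1 * q.
  by rewrite -mulrA ler_pM2l ?invr_gt0 // -ler_pdivlMl ?invr_gt0 // invrK.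
have : k^-1 * q <= m by lra.
by rewrite -ler_pdivlMl ?invr_gt0 // invrK.
Qed.

End InnerProduct.

(** * Extreme eigenvalues as bounds on the Rayleigh quotient *)

Section ExtremeEigenvalues.
Context (R : realType) (d : nat).
Implicit Types (x : 'cV[R]_d) (A : 'M[R]_d).

Lemma quad_bound A : exists2 K, 0 < K & forall x, `|dot x (A *m x)| <= K * dot x x.
Proof.
have [K K0 AK] := mulmx_bound A; exists (1 + K) => [|x]; first by rewrite addr_gt0.
have := dot_ge0 (x + A *m x); have := dot_ge0 (x - A *m x).
rewrite !dotE (dotC (A *m x) x) => h1 h2; have := AK x; have := dot_ge0 x.
by move=> h3 h4; rewrite ler_norml; apply/andP; split; lra.
Qed.

(** With [K'] a bound for the inverse and [K] one for the form, [|x|^2 = |A^-1 A x|^2 <= K' |A x|^2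
    <= K' K <x, A x>]; the last step is [psd_sqr_le]. *)
Lemma psd_unit_coercive A : sym_psd A -> A \in unitmx ->
  exists2 e, 0 < e & forall x, e * dot x x <= dot x (A *m x).
Proof.
move=> pA uA; have [K K0 AK] := quad_bound A.
have [K' K'0 AK'] := mulmx_bound (invmx A).
exists (K' * K)^-1 => [|x]; first by rewrite invr_gt0 mulr_gt0.
rewrite ler_pdivrMl ?mulr_gt0 // -{1 2}[x](mulKmx uA).
apply: (le_trans (AK' _)); rewrite -mulrA ler_pM2l //.
by apply: psd_sqr_le => // y; apply: le_trans (AK y); exact: ler_norm.
Qed.

(* The infimum [m] of the Rayleigh quotient is an eigenvalue, since otherwise
   [A - m I] would be invertible, hence coercive. *)
Lemma rayleigh_eigenvalue A x0 : A^T = A -> x0 != 0 ->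
  exists2 m, eigenvalue A m & forall x, m * dot x x <= dot x (A *m x).
Proof.
move=> sA x00.
have n0 : forall x, x != 0 -> 0 < dot x x.
  by move=> x xn0; rewrite lt_neqAle dot_ge0 eq_sym dot_eq0 xn0.
have [K K0 AK] := quad_bound A.
pose E := [set dot x (A *m x) / dot x x | x in [set x : 'cV[R]_d | x != 0]].
have E0 : E !=set0 by exists (dot x0 (A *m x0) / dot x0 x0); exists x0.
have lE : has_lbound E.
  exists (- K) => _ [x /= xn0 <-]; rewrite ler_pdivlMr ?n0 // mulNr.
  by have := AK x; rewrite ler_norml => /andP[].
have mE x : inf E * dot x x <= dot x (A *m x).
  have [->|xn0] := eqVneq x 0; first by rewrite !dot0l mulr0.
  by rewrite -ler_pdivlMr ?n0 //; apply: ge_inf => //; exists x.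
exists (inf E) => //.
rewrite /eigenvalue /eigenspace kermx_eq0 row_free_unit; apply/negP => uA.
have eqB x : dot x ((A - (inf E)%:M) *m x) = dot x (A *m x) - inf E * dot x x.
  by rewrite mulmxBl mul_scalar_mx !dotE.
have [|e e0 Be] := psd_unit_coercive _ uA.
  apply/sym_psdP; split=> [|x]; first by rewrite linearB /= sA tr_scalar_mx.
  by rewrite eqB subr_ge0.
suff : inf E + e <= inf E by rewrite gerDl leNgt e0.
apply: lb_le_inf => // _ [x /= xn0 <-]; rewrite ler_pdivlMr ?n0 //.
by have := Be x; rewrite eqB; lra.
Qed.

(** [eigenvalue] speaks of row vectors; symmetry lets the eigenvector be transposed. *)
Lemma eigenvalue_sym A k : A^T = A -> eigenvalue A k ->
  exists2 x : 'cV[R]_d, x != 0 & A *m x = k *: x.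
Proof.
move=> sA /eigenvalueP[v vA v0]; exists v^T; first by rewrite trmx_eq0.
by rewrite -{1}sA -trmx_mul vA linearZ.
Qed.

Lemma lambda_min_le A x : A^T = A -> lambda_min A * dot x x <= dot x (A *m x).
Proof.
move=> sA; have [->|xn0] := eqVneq x 0; first by rewrite !dot0l mulr0.
have [m em mA] := rayleigh_eigenvalue sA xn0.
apply: le_trans (mA x); rewrite ler_wpM2r ?dot_ge0 //.
(* The eigenvalue [m] is itself the lower bound of the spectrum that [ge_inf] asks for, as every
   eigenvalue is the Rayleigh quotient of its eigenvector. *)
apply: ge_inf => //; exists m => k /= /(eigenvalue_sym sA)[y yn0 yA].
have := mA y; rewrite yA dotZr ler_pM2r //.
by rewrite lt_neqAle dot_ge0 eq_sym dot_eq0 yn0.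
Qed.

Lemma lambda_minN A : lambda_min (- A) = - lambda_max A.
Proof.
rewrite /lambda_min /lambda_max /inf; congr (- sup _).
apply/seteqP; split=> [_ [k /= /eigenvalueP[v vA v0] <-]|k /= /eigenvalueP[v vA v0]].
  apply/eigenvalueP; exists v => //.
  by rewrite scaleNr -vA mulmxN opprK.
exists (- k); rewrite ?opprK //; apply/eigenvalueP; exists v => //.
by rewrite mulmxN vA scaleNr.
Qed.

Lemma le_lambda_max A x : A^T = A -> dot x (A *m x) <= lambda_max A * dot x x.
Proof.
move=> sA; have := @lambda_min_le (- A) x.
by rewrite linearN /= sA lambda_minN mulNmx dotNr mulNr lerN2; exact.
Qed.

(** In dimension 0 the spectrum is empty and its [inf] takes the default value 0. *)
Lemma lambda_min_gt0_dim A : 0 < lambda_min A -> (0 < d)%N.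
Proof.
apply: contraTT; rewrite -leqNgt leqn0 => /eqP d0; rewrite -leNgt.
rewrite /lambda_min (_ : mkset _ = set0) ?inf0 // -subset0 => k /= /eigenvalueP[v _].
by case/eqP; apply/rowP => i; have := ltn_ord i; rewrite {2}d0.
Qed.

End ExtremeEigenvalues.

(** * Gradient and minimizers of a quadratic function *)

Section Quadratic.
Context (R : realType) (d : nat).
Implicit Types (x w v c : 'cV[R]_d) (A : 'M[R]_d).

Lemma quad_funE A c w : quad_fun A c w = 2^-1 * dot w (A *m w) - dot c w.
Proof. by rewrite /quad_fun mx_quad mx_dot. Qed.

Lemma quad_fun_expand A c w v (h : R) : A^T = A ->
  quad_fun A c (w + h *: v) =
  quad_fun A c w + h * dot (A *m w - c) v + h ^+ 2 / 2 * dot v (A *m v).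
Proof.
move=> sA; rewrite !quad_funE mulmxDr -scalemxAr !dotE.
rewrite (dotC v (A *m w)) -(dot_sym w v sA); by field.
Qed.

Lemma gradient_quad A c w : A^T = A -> gradient (quad_fun A c) w = A *m w - c.
Proof.
move=> sA; apply/colP => j; rewrite mxE; set v := delta_mx j 0.
have -> : (A *m w - c) j 0 = dot (A *m w - c) v.
  rewrite /dot (bigD1 j) //= big1 ?addr0 => [|i ij]; rewrite !mxE ?eqxx ?mulr1 //.
  by rewrite (negPf ij) mulr0.
set l := dot _ v; pose q := 2^-1 * dot v (A *m v).
apply: cvg_lim => //.
(* By the exact second-order expansion, the difference quotient at [h != 0] is [l + h * q]. *)
have cl : (fun h : R => l + h * q) @ 0^' --> l.
  have : (fun h : R => l + h * q) @ (0 : R) --> l + 0 * q.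
    by apply: cvgD; [exact: cvg_cst|apply: cvgMl; exact: cvg_id].
  by rewrite mul0r addr0; exact: cvg_within_filter.
apply: cvg_trans cl; apply: near_eq_cvg; near=> h => /=.
have h0 : h != 0 by near: h; exact: nbhs_dnbhs_neq.
rewrite [h *: v + w]addrC quad_fun_expand // -/l /q.
by rewrite /GRing.scale /=; field.
Unshelve. all: by end_near.
Qed.

Lemma quad_argmin A c w : sym_psd A ->
  (forall v, quad_fun A c w <= quad_fun A c v) -> A *m w = c.
Proof.
move=> pA hw; have [sA _] := pA; have [K K0 AK] := quad_bound A.
apply/eqP; rewrite -subr_eq0 -dot_eq0; set g := A *m w - c.
(* A gradient step of length [1 / K] lowers the function by at least [|g|^2 / (2 K)], so minimality
   forces [g = 0]. *)
have := hw (w + (- K^-1) *: g); rewrite quad_fun_expand // -/g sqrrN => h.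
have h2 : K^-1 ^+ 2 / 2 * dot g (A *m g) <= K^-1 / 2 * dot g g.
  apply: (@le_trans _ _ (K^-1 ^+ 2 / 2 * (K * dot g g))).
    rewrite ler_pM2l ?divr_gt0 ?exprn_gt0 ?invr_gt0 //.
    exact: le_trans (ler_norm _) (AK g).
  by rewrite le_eqVlt; apply/orP; left; apply/eqP; field; rewrite gt_eqF.
rewrite eq_le dot_ge0 andbT -(@pmulr_rle0 _ K^-1) ?invr_gt0 //; lra.
Qed.

End Quadratic.

(** * Expectations along a chain driven by independent finite draws *)

Section FiniteChain.
Context (disp : measure_display) (Omega : measurableType disp) (R : realType)
  (P : probability Omega R) (S : finType) (B : nat -> Omega -> S) (p : S -> R)
  (Z : Type) (step : S -> Z -> Z) (z0 : Z).

Fixpoint chain (k : nat) (omega : Omega) : Z :=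
  if k is j.+1 then step (B j omega) (chain j omega) else z0.

(** The Markov operator of the chain: the mean of [h] after one step from [z]. *)
Definition transition (h : Z -> R) (z : Z) : R := \sum_s p s * h (step s z).

Let transitionE h z : transition h z = \sum_s p s * h (step s z). Proof. by []. Qed.

Lemma iter_transition_sum (I : finType) (q : I -> R) (g : I -> Z -> R) k z :
  iter k transition (fun z => \sum_i q i * g i z) z =
  \sum_i q i * iter k transition (g i) z.
Proof.
elim: k z => //= k IH z; rewrite transitionE.
under [LHS]eq_bigr do rewrite IH mulr_sumr.
rewrite exchange_big; apply: eq_bigr => i _; rewrite transitionE mulr_sumr.
by apply: eq_bigr => s _; rewrite mulrCA.
Qed.

Hypothesis B_dist : forall k s, measurable (B k @^-1` [set s]) /\
  P (B k @^-1` [set s]) = (p s)%:E.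
Hypothesis B_indep : mutually_independent P B.

Lemma chainS_sum (h : Z -> R) k omega : h (chain k.+1 omega) =
  \sum_s \1_(B k @^-1` [set s]) omega * h (step s (chain k omega)).
Proof.
rewrite (bigD1 (B k omega)) //= big1 ?addr0 => [|s sB]; rewrite indicE.
  by rewrite mem_set // mul1r.
by rewrite memNset ?mul0r //= => Bs; rewrite Bs eqxx in sB.
Qed.

(** [Z] carries no sigma-algebra, so the induction runs over all real observables [h] at once:
    splitting on the last draw replaces [h] by the functions [h \o step s]. *)
Lemma measurable_chain (h : Z -> R) k : measurable_fun setT (h \o chain k).
Proof.
elim: k h => [|k IH] h; first exact: (measurable_cst (h z0)).
rewrite (_ : _ \o _ = fun omega => h (chain k.+1 omega)) //.
rewrite (funext (chainS_sum h k)); apply: measurable_sum => s.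
apply: measurable_funM; last exact: (IH (h \o step s)).
by apply: measurable_indic; case: (B_dist k s).
Qed.

Definition cylinder (J : seq nat) (sigma : nat -> S) : set Omega :=
  \bigcap_(j in [set` J]) (B j @^-1` [set sigma j]).

Lemma measurable_cylinder J sigma : measurable (cylinder J sigma).
Proof. by apply: bigcap_measurableType => j _; case: (B_dist j (sigma j)). Qed.

Lemma cylinder_cons J sigma k s : k \notin J ->
  cylinder J sigma `&` (B k @^-1` [set s]) =
  cylinder (k :: J) (fun j => if j == k then s else sigma j).
Proof.
move=> kJ; have neq_k j : j \in J -> (j == k) = false.
  by move=> jJ; apply/negP => /eqP jk; rewrite -jk jJ in kJ.
apply/seteqP; split=> [omega [DJ Dk] j|omega D].
  rewrite /= in_cons => /orP[/eqP ->|jJ]; first by rewrite eqxx.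
  by rewrite neq_k //; exact: DJ.
split=> [j jJ|]; last by have := D k; rewrite /= mem_head eqxx; exact.
by have := D j; rewrite /= in_cons jJ orbT neq_k //; exact.
Qed.

(** This replaces conditioning on the past. The state at time [k] depends on the draws before [k],
    the cylinder on later ones. In the induction the last draw is moved from the chain into the
    cylinder, hence the generality in [J] and [h]; independence enters only at [k = 0], where the
    cylinder has product probability. *)
Lemma integral_chain_cylinder (h : Z -> R) k J sigma :
  (forall z, 0 <= h z) -> uniq J -> all (leq k) J ->
  (\int[P]_(omega in cylinder J sigma) (h (chain k omega))%:E =
   (\prod_(j <- J) p (sigma j) * iter k transition h z0)%:E)%E.
Proof.
elim: k h J sigma => [|k IH] h J sigma h0 uJ kJ.
  have PJ : P (cylinder J sigma) = (\prod_(j <- J) p (sigma j))%:E.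
    rewrite [LHS](B_indep (fun j => [set sigma j]) uJ) -prodEFin.
    by apply: eq_bigr => j _; rewrite (B_dist _ _).2.
  transitivity ((h z0)%:E * P (cylinder J sigma))%E.
    exact: (integral_cst P (measurable_cylinder J sigma) (h z0)%:E).
  by rewrite PJ -EFinM mulrC.
have kNJ : k \notin J by apply/negP => /(allP kJ); rewrite ltnn.
under eq_integral do rewrite chainS_sum -sumEFin.
rewrite ge0_integral_sum.
- rewrite iterSr iter_transition_sum mulr_sumr -sumEFin.
  apply: eq_bigr => s _.
  transitivity (\int[P]_(omega in cylinder J sigma `&` (B k @^-1` [set s]))
                 (h (step s (chain k omega)))%:E)%E.
    rewrite integral_mkcondr; apply: eq_integral => omega _.
    by rewrite patchE indicE; case: ifP => _; rewrite ?mul1r ?mul0r.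
  rewrite cylinder_cons // (IH (h \o step s)) //=; last 2 first.
  + by rewrite kNJ.
  + by rewrite leqnn; apply/allP => j /(allP kJ); exact: ltnW.
  congr EFin; rewrite big_cons eqxx mulrCA mulrA; congr (_ * _ * _).
  apply: eq_big_seq => j jJ; case: eqP => // jk.
  by rewrite -jk jJ in kNJ.
- exact: measurable_cylinder.
- move=> s; apply/measurable_EFinP; apply: measurable_funTS.
  apply: measurable_funM; last exact: (measurable_chain (h \o step s)).
  by apply: measurable_indic; case: (B_dist k s).
- by move=> s omega _; rewrite lee_fin mulr_ge0 // indicE ler0n.
Qed.

Lemma expectation_chain (h : Z -> R) k : (forall z, 0 <= h z) ->
  ('E_P[h \o chain k] = (iter k transition h z0)%:E)%E.
Proof.
move=> h0; rewrite unlock.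
(* A sample point supplies an arbitrary [sigma] for the empty list of times, whose cylinder is the
   whole space. *)
have [omega _] : [set: Omega] !=set0.
  apply/set0P; apply/eqP => T0; have := probability_setT P.
  by rewrite T0 measure0 => /eqP; rewrite eqe eq_sym oner_eq0.
have := @integral_chain_cylinder h k [::] (fun=> B 0 omega) h0 isT isT.
by rewrite big_nil mul1r /cylinder set_nil bigcap_set0.
Qed.

Lemma iter_transition_mono (g h : Z -> R) k z : (forall s, 0 <= p s) ->
  (forall z, g z <= h z) -> iter k transition g z <= iter k transition h z.
Proof.
move=> p0 gh; elim: k z => //= k IH z.
by apply: ler_sum => s _; apply: ler_wpM2l; [exact: p0|exact: IH].
Qed.

(** The affine recursion is unrolled; the additive terms form the geometric sum
    [1 + r + ... + r ^ (k - 1)]. *)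
Lemma iter_transition_le (N : Z -> R) r e k z :
  (forall s, 0 <= p s) -> \sum_s p s = 1 -> 0 <= r -> r < 1 ->
  (forall z, transition N z <= r * N z + e) ->
  iter k transition N z <= r ^+ k * N z + e * (1 - r ^+ k) / (1 - r).
Proof.
move=> p0 p1 r0 r1 hN; elim: k z => [|k IH] z.
  by rewrite expr0 subrr mulr0 mul0r addr0 mul1r.
apply: (@le_trans _ _ (\sum_s p s *
    (r ^+ k * N (step s z) + e * (1 - r ^+ k) / (1 - r)))).
  by apply: ler_sum => s _; apply: ler_wpM2l; [exact: p0|exact: IH].
under eq_bigr do rewrite mulrDr mulrCA.
rewrite big_split -mulr_sumr -mulr_suml p1 mul1r /=.
apply: (@le_trans _ _ (r ^+ k * (r * N z + e) + e * (1 - r ^+ k) / (1 - r))).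
  by rewrite lerD2r ler_wpM2l ?exprn_ge0 // hN.
rewrite le_eqVlt; apply/orP; left; apply/eqP; rewrite exprS; field.
by rewrite subr_eq0 gt_eqF.
Qed.

End FiniteChain.

(** * Second moment of a sum sampled without replacement *)

Section SamplingVariance.
Context (R : realType) (n b : nat).
Hypotheses (n2 : (2 <= n)%N) (bn : (b <= n)%N) (b0 : (0 < b)%N).

Definition draw_prob (S : {set 'I_n}) : R := if #|S| == b then 'C(n, b)%:R^-1 else 0.

Lemma draw_prob_ge0 S : 0 <= draw_prob S.
Proof. by rewrite /draw_prob; case: ifP => _ //; rewrite invr_ge0 ler0n. Qed.

Let bin_neq0 : 'C(n, b)%:R != 0 :> R.
Proof. by rewrite pnatr_eq0 -lt0n bin_gt0. Qed.

Lemma sum_draw_prob_avoid (D : {set 'I_n}) :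
  \sum_S draw_prob S * (S \subset ~: D)%:R = 'C(n - #|D|, b)%:R / 'C(n, b)%:R.
Proof.
have -> : (n - #|D|)%N = #|~: D| by rewrite (cardsCs (~: D)) finset.setCK card_ord.
rewrite -cards_draws.
rewrite -sum1_card natr_sum mulr_suml [RHS]big_mkcond /=.
apply: eq_bigr => S _; rewrite inE /draw_prob mul1r.
by case: (S \subset _); case: ifP => _ /=; rewrite ?mulr1 ?mulr0.
Qed.

Lemma sum_draw_prob : \sum_S draw_prob S = 1.
Proof.
have := sum_draw_prob_avoid finset.set0; rewrite cards0 subn0 divff // => <-.
by apply: eq_bigr => S _; rewrite finset.setC0 finset.subsetT mulr1.
Qed.

(** The case [m < b], where both binomials vanish, does occur: for [m = n - 1] and [b = n]. *)
Let bin_pred m : (0 < m)%N ->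
  m%:R * 'C(m.-1, b)%:R = (m%:R - b%:R) * 'C(m, b)%:R :> R.
Proof.
move=> m0; have [bm|mb] := leqP b m.
  by rewrite -natrB // -!natrM mul_bin_down.
by rewrite !bin_small ?mulr0 // (leq_ltn_trans (leq_pred _)).
Qed.

Let n_neq0 : n%:R != 0 :> R. Proof. by rewrite pnatr_eq0 -lt0n (ltn_trans _ n2). Qed.
Let n1_neq0 : n%:R - 1 != 0 :> R.
Proof. by rewrite subr_eq0 (eqr_nat R n 1) gtn_eqF. Qed.

Lemma draw_prob_avoid1 i : \sum_S draw_prob S * (S \subset ~: [set i])%:R =
  (n%:R - b%:R) / n%:R.
Proof.
rewrite sum_draw_prob_avoid cards1 subn1; apply: (mulfI n_neq0).
rewrite mulrA bin_pred ?(ltn_trans _ n2) //; by field; rewrite n_neq0 bin_neq0.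
Qed.

Lemma draw_prob_avoid2 i j : i != j ->
  \sum_S draw_prob S * (S \subset ~: [set i; j])%:R =
  (n%:R - b%:R) / n%:R * ((n%:R - 1 - b%:R) / (n%:R - 1)).
Proof.
move=> ij; rewrite sum_draw_prob_avoid cards2 ij /= subn2.
have n1 : (0 < n.-1)%N by rewrite -subn1 subn_gt0.
have E1 : n.-1%:R = n%:R - 1 :> R by rewrite -subn1 natrB // (ltn_trans _ n2).
have := bin_pred n1; have := bin_pred (ltn_trans (ltn0Sn 0) n2).
rewrite E1.
set c1 := 'C(n.-1, b)%:R; set c2 := 'C(n.-2, b)%:R => h1 h2.
apply: (mulfI n1_neq0); rewrite [LHS]mulrA h2; apply: (mulfI n_neq0).
rewrite (_ : n%:R * _ = (n%:R - 1 - b%:R) * (n%:R * c1) / 'C(n, b)%:R); last by ring.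
by rewrite h1; field; rewrite n_neq0 n1_neq0 bin_neq0.
Qed.

(* As [u] sums to 0, the sum over a draw is minus the sum over the elements
   that it avoids. *)
Lemma draw_variance (u : 'I_n -> R) : \sum_i u i = 0 ->
  \sum_S draw_prob S * (\sum_(i in S) u i) ^+ 2 =
  b%:R * (n%:R - b%:R) / (n%:R * (n%:R - 1)) * \sum_i u i ^+ 2.
Proof.
move=> u0; set q1 : R := (n%:R - b%:R) / n%:R.
set q2 : R := q1 * ((n%:R - 1 - b%:R) / (n%:R - 1)).
pose av (S : {set 'I_n}) i : R := (i \notin S)%:R.
have avE (S : {set 'I_n}) : (\sum_(i in S) u i) ^+ 2 =
    \sum_i \sum_j u i * u j * (S \subset ~: [set i; j])%:R.
  have -> : \sum_(i in S) u i = - \sum_i u i * av S i.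
    apply/eqP; rewrite -addr_eq0; apply/eqP; rewrite -[RHS]u0 [RHS](bigID (mem S)) /=.
    congr +%R; rewrite [RHS]big_mkcond /=; apply: eq_bigr => i _.
    by rewrite /av; case: (i \in S); rewrite ?mulr1 ?mulr0.
  rewrite sqrrN expr2 mulr_suml; apply: eq_bigr => i _.
  rewrite mulr_sumr; apply: eq_bigr => j _.
  rewrite mulrACA /av -natrM mulnb.
  by rewrite finset.subsetC finset.subUset !finset.sub1set !inE.
transitivity (\sum_i \sum_j u i * u j * (if i == j then q1 else q2)).
  under eq_bigr do rewrite avE mulr_sumr.
  rewrite exchange_big; apply: eq_bigr => i _.
  under eq_bigr do rewrite mulr_sumr.
  rewrite exchange_big; apply: eq_bigr => j _.
  under eq_bigr do rewrite mulrCA.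
  rewrite -mulr_sumr; congr (_ * _).
  case: eqVneq => [->|ij]; last exact: draw_prob_avoid2.
  by rewrite finset.setUid draw_prob_avoid1.
(* Since [u] sums to 0, the off-diagonal terms of row [i] add up to [- q2 * u i ^+ 2]. *)
have row i : \sum_j u i * u j * (if i == j then q1 else q2) = (q1 - q2) * u i ^+ 2.
  transitivity (u i * ((q1 - q2) * u i) + u i * q2 * \sum_j u j); last first.
    by rewrite u0; ring.
  rewrite (bigD1 i) //= eqxx [in RHS](bigD1 i) //= mulrDr addrA; congr (_ + _).
    by ring.
  rewrite mulr_sumr; apply: eq_bigr => j ji; rewrite eq_sym (negPf ji); ring.
under eq_bigr do rewrite row; rewrite -mulr_sumr; congr (_ * _).
by rewrite /q2 /q1; field; rewrite n_neq0 n1_neq0.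
Qed.

End SamplingVariance.

(** * Mean error of a mini-batch average *)

Section BatchNoise.
Context (R : realType) (d n b : nat).
Hypotheses (n2 : (2 <= n)%N) (bn : (b <= n)%N) (b0 : (0 < b)%N).

Lemma sum_sqr_centered (u : 'I_n -> R) :
  \sum_i (u i - n%:R^-1 * \sum_k u k) ^+ 2 <= \sum_i u i ^+ 2.
Proof.
set U := \sum_k u k; set m := n%:R^-1 * U.
have n0 : n%:R != 0 :> R by rewrite pnatr_eq0 -lt0n (ltn_trans _ n2).
have -> : \sum_i (u i - m) ^+ 2 = \sum_i u i ^+ 2 - n%:R * m ^+ 2.
  transitivity (\sum_i (u i ^+ 2 - 2 * m * u i + m ^+ 2)).
    by apply: eq_bigr => i _; ring.
  rewrite !big_split /= sumrN -mulr_sumr sumr_const card_ord -/U -[_ ^+ 2 *+ n]mulr_natl.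
  by rewrite /m; field.
by rewrite gerBl mulr_ge0 ?sqr_ge0.
Qed.

Definition batch_noise (v : 'I_n -> 'cV[R]_d) (S : {set 'I_n}) : 'cV[R]_d :=
  b%:R^-1 *: \sum_(i in S) v i - n%:R^-1 *: \sum_i v i.

Lemma batch_noise_sqr (v : 'I_n -> 'cV[R]_d) :
  \sum_S draw_prob R b S * dot (batch_noise v S) (batch_noise v S) <=
  (n%:R - b%:R) / ((n%:R - 1) * b%:R) * (n%:R^-1 * \sum_i dot (v i) (v i)).
Proof.
have n_neq0 : n%:R != 0 :> R by rewrite pnatr_eq0 -lt0n (ltn_trans _ n2).
have b_neq0 : b%:R != 0 :> R by rewrite pnatr_eq0 -lt0n.
have n1_gt0 : 0 < n%:R - 1 :> R by rewrite subr_gt0 (ltr_nat R 1 n).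
pose m j := n%:R^-1 * \sum_i v i j 0.
have -> : \sum_S draw_prob R b S * dot (batch_noise v S) (batch_noise v S) =
    \sum_j \sum_S draw_prob R b S * (b%:R^-1 * \sum_(i in S) (v i j 0 - m j)) ^+ 2.
  rewrite exchange_big; apply: eq_bigr => S _; rewrite -mulr_sumr.
  (* Draws of size other than [b] have weight 0; for the others, dividing by [b] turns the [b]
     copies of [m j] into the full mean. *)
  rewrite /draw_prob; case: eqP => [Sb|_]; last by rewrite !mul0r.
  congr (_ * _); apply: eq_bigr => j _; rewrite -expr2; congr (_ ^+ 2).
  rewrite !mxE !summxE sumrB sumr_const Sb mulrBr -/(m j).
  by rewrite -[m j *+ b]mulr_natl mulKf.
have -> : \sum_i dot (v i) (v i) = \sum_j \sum_i v i j 0 ^+ 2.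
  rewrite [RHS]exchange_big; apply: eq_bigr => i _.
  by apply: eq_bigr => j _; rewrite expr2.
rewrite !mulr_sumr; apply: ler_sum => j _.
under eq_bigr do rewrite exprMn mulrCA.
rewrite -mulr_sumr (draw_variance n2 bn); last first.
  by rewrite sumrB sumr_const card_ord -[m j *+ n]mulr_natl /m mulVKf ?subrr.
apply: (@le_trans _ _ ((n%:R - b%:R) / ((n%:R - 1) * b%:R) *
    (n%:R^-1 * \sum_i (v i j 0 - m j) ^+ 2))).
  rewrite le_eqVlt; apply/orP; left; apply/eqP; field.
  by rewrite n_neq0 b_neq0 gt_eqF.
rewrite !mulrA ler_wpM2l ?sum_sqr_centered // mulr_ge0 ?invr_ge0 //.
by rewrite divr_ge0 ?subr_ge0 ?ler_nat ?mulr_ge0 // ltW.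
Qed.

(** The difference of the two sides is a variance. This passes from the second moment of the noise
    to its mean norm. *)
Lemma wmean_sqr_le (I : finType) (p x : I -> R) : (forall i, 0 <= p i) ->
  \sum_i p i = 1 -> (\sum_i p i * x i) ^+ 2 <= \sum_i p i * x i ^+ 2.
Proof.
move=> p0 p1; set m := \sum_i p i * x i; rewrite -subr_ge0.
rewrite (_ : _ - _ = \sum_i p i * (x i - m) ^+ 2).
  by apply: sumr_ge0 => i _; rewrite mulr_ge0 ?sqr_ge0.
transitivity (\sum_i (p i * x i ^+ 2 - 2 * m * (p i * x i) + m ^+ 2 * p i)).
  by rewrite !big_split /= sumrN -!mulr_sumr p1 -/m; ring.
by apply: eq_bigr => i _; ring.
Qed.

Lemma batch_noise_mean (v : 'I_n -> 'cV[R]_d) K : 0 <= K ->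
  n%:R^-1 * \sum_i dot (v i) (v i) <= K ^+ 2 ->
  \sum_S draw_prob R b S * enorm (batch_noise v S) <=
  Num.sqrt ((n%:R - b%:R) / ((n%:R - 1) * b%:R)) * K.
Proof.
move=> K0 vK.
have c0 : 0 <= (n%:R - b%:R) / ((n%:R - 1) * b%:R) :> R.
  rewrite divr_ge0 ?mulr_ge0 ?subr_ge0 ?ler_nat //.
  by rewrite (ler_nat R 1 n) (ltn_trans _ n2).
rewrite -(@ler_pXn2r _ 2) ?nnegrE ?mulr_ge0 ?sqrtr_ge0 //; last first.
  by apply: sumr_ge0 => S _; rewrite mulr_ge0 ?enorm_ge0 ?draw_prob_ge0.
apply: le_trans (wmean_sqr_le _ _ _) _ => [S||].
- exact: draw_prob_ge0.
- exact: sum_draw_prob.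
- under eq_bigr do rewrite enorm_sqr.
  apply: (le_trans (batch_noise_sqr v)).
  by rewrite exprMn sqr_sqrtr // ler_wpM2l.
Qed.

End BatchNoise.

(** * Lyapunov function of the heavy-ball iteration *)

Section Lyapunov.
Context (R : realType) (d : nat) (X : 'M[R]_d) (s : R).
Hypotheses (symX : X^T = X) (s0 : 0 < s) (s1 : s <= 1)
  (X_ge : forall x, s ^+ 2 * dot x x <= dot x (X *m x))
  (X_le : forall x, dot (X *m x) (X *m x) <= dot x (X *m x)).
Implicit Types x y e : 'cV[R]_d.

Let beta : R := (1 - 2^-1 * s) ^+ 2.
Let M x : 'cV[R]_d := (1 + beta) *: x - X *m x.

(* On an eigenvector of [X] the iteration [x_(k+1) = M x_k - beta x_(k-1)] is a
   scalar recurrence with characteristic polynomial [t^2 - M t + beta]; this is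
   its homogeneous form in [(x_k, x_(k-1))], which the iteration multiplies by
   [beta]. *)
Definition lyap x y : R :=
  dot x x - dot ((1 + beta) *: x - X *m x) y + beta * dot y y.

Let beta_gt0 : 0 < beta.
Proof. have h1 := s1; rewrite exprn_gt0 // subr_gt0; lra. Qed.

Let M_sym x y : dot (M x) y = dot x (M y).
Proof. by rewrite /M !dotE dot_sym. Qed.

(** This is [M^2 <= (4 beta - 2 beta s^2) I]: the characteristic roots are complex, with a margin.
    As [X^2 <= X] and [X >= s^2 I], [M^2 <= ((1 + beta)^2 - (1 + 2 beta) s^2) I], and
    [1 - beta = s - s^2 / 4 <= s]. *)
Let M_sqr x : dot (M x) (M x) + 2 * beta * s ^+ 2 * dot x x <= 4 * beta * dot x x.
Proof.
have [hs0 hs1 hb] := And3 s0 s1 beta_gt0.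
have := X_le x; have := X_ge x; have := dot_ge0 x.
rewrite /M dot_scaleB_sqr.
set q := dot x x; set m := dot x (X *m x); set z := dot (X *m x) _ => q0 h1 h2.
have h3 : (1 + 2 * beta) * (s ^+ 2 * q) <= (1 + 2 * beta) * m.
  by rewrite ler_pM2l //; lra.
have h4 : (1 - beta) ^+ 2 * q <= s ^+ 2 * q.
  rewrite ler_wpM2r // -subr_ge0.
  have -> : s ^+ 2 - (1 - beta) ^+ 2 = s ^+ 2 * ((s / 4) * (2 - s / 4)).
    by rewrite /beta; field.
  by apply: mulr_ge0; [exact: sqr_ge0|apply: mulr_ge0; lra].
lra.
Qed.

(** Completing the square in [y] gives [4 beta V >= 4 beta |x|^2 - |M x|^2 >= 2 beta s^2 |x|^2]. The
    constant 2 would do; 9 is a perfect square and yields the factor [3 / s] after taking roots. *)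
Lemma lyap_ge x y : s ^+ 2 * dot x x <= 9 * lyap x y.
Proof.
have hb := beta_gt0; have := dot_ge0 ((2 * beta) *: y - M x); have := M_sqr x.
have : 0 <= s ^+ 2 * dot x x by rewrite mulr_ge0 ?sqr_ge0 ?dot_ge0.
rewrite /lyap -/(M x) dot_scaleB_sqr (dotC y (M x)).
set q := dot x x; set m := dot (M x) y; set z := dot (M x) (M x).
set w := dot y y => q0 h1 h2.
have : 0 <= (4 * beta) * ((q - m + beta * w) - s ^+ 2 * q / 2) by lra.
rewrite pmulr_rge0 => [h3|]; last exact: mulr_gt0.
lra.
Qed.

Lemma lyap_ge0 x y : 0 <= lyap x y.
Proof.
have := lyap_ge x y; have : 0 <= s ^+ 2 * dot x x.
  by rewrite mulr_ge0 ?sqr_ge0 ?dot_ge0.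
by move=> h1 h2; lra.
Qed.

(** [2 x - M y] is the gradient of [lyap] in its first argument, so this controls the term linear in
    the perturbation. *)
Lemma lyap_ge_sqr x y : dot (2 *: x - M y) (2 *: x - M y) <= 4 * lyap x y.
Proof.
have hb := beta_gt0; have := M_sqr y.
have : 0 <= 2 * beta * s ^+ 2 * dot y y.
  apply: mulr_ge0; last exact: dot_ge0.
  by apply: mulr_ge0; [apply: mulr_ge0 => //; exact: ltW|exact: sqr_ge0].
rewrite /lyap -/(M x) dot_scaleB_sqr (M_sym x y) => h1 h2; lra.
Qed.

Lemma lyap_step x y e :
  lyap (M x - beta *: y + e) x =
  beta * lyap x y + dot (2 *: (M x - beta *: y) - M x) e + dot e e.
Proof.
rewrite /lyap -!/(M _) (M_sym (_ + e)).
move: (M x) => m; rewrite !dotE (dotC e m) (dotC e y) (dotC y m).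
by ring.
Qed.

(** On the diagonal, where the iteration starts, [lyap x x] collapses to [<x, X x>]. *)
Lemma lyap_diag x : lyap x x <= dot x x.
Proof.
have := X_le x; have := dot_ge0 (1 *: x - X *m x).
rewrite dot_scaleB_sqr /lyap !dotE (dotC (X *m x) x) => h1 h2; lra.
Qed.

Definition lyap_norm x y : R := Num.sqrt (lyap x y).

Lemma enorm_le_lyap x y : enorm x <= 3 / s * lyap_norm x y.
Proof.
have hs := s0; have hs' := ltW s0; rewrite mulrAC ler_pdivlMr // enormE /lyap_norm.
rewrite -(@ler_pXn2r _ 2) ?nnegrE ?mulr_ge0 ?sqrtr_ge0 //.
rewrite !exprMn !sqr_sqrtr ?dot_ge0 ?lyap_ge0 // mulrC.
by rewrite (_ : 3 ^+ 2 = 9) ?lyap_ge //; ring.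
Qed.

Lemma lyap_norm_step x y e :
  lyap_norm ((1 + beta) *: x - X *m x - beta *: y + e) x <=
  (1 - 2^-1 * s) * lyap_norm x y + enorm e.
Proof.
have [hs0 hs1] := (s0, s1); have r0 : 0 <= 1 - 2^-1 * s by lra.
rewrite -/(M x); set x' := M x - beta *: y; set N := lyap_norm x y.
have N0 : 0 <= N by exact: sqrtr_ge0.
have NN : N ^+ 2 = lyap x y by rewrite sqr_sqrtr ?lyap_ge0.
rewrite /lyap_norm lyap_step -NN /beta -exprMn; set r := _ * N.
have rge0 : 0 <= r by rewrite mulr_ge0.
rewrite -(@ler_pXn2r _ 2) ?nnegrE ?addr_ge0 ?sqrtr_ge0 ?enorm_ge0 //.
(* [lyap_ge_sqr] at [(x', x)] bounds the gradient by [2 r], because [lyap_step] with [e = 0] gives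
   [lyap x' x = r^2]. The new value is then at most [(r + |e|)^2]. *)
have cs : dot (2 *: x' - M x) e <= 2 * r * enorm e.
  apply: (le_trans (dot_le_enorm _ _)); rewrite ler_wpM2r ?enorm_ge0 //.
  rewrite -(@ler_pXn2r _ 2) ?nnegrE ?mulr_ge0 ?enorm_ge0 // enorm_sqr.
  apply: (le_trans (lyap_ge_sqr _ _)).
  rewrite -[X in lyap X](addr0 x') lyap_step dotC !dot0l -NN /r /beta.
  by rewrite le_eqVlt; apply/orP; left; apply/eqP; ring.
rewrite sqr_sqrtr; last first.
  by rewrite /r exprMn -/beta NN -lyap_step lyap_ge0.
rewrite -/x' -enorm_sqr sqrrD mulr2n; lra.
Qed.

End Lyapunov.

(** Here [k] stands for [kappa * zeta]. From [72 k <= 1], [3 s k <= s / 24], so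
    [1 - r >= 11 s / 24], more than [3 s / 8]. The other branch of the maximum needs
    [3 k <= sqrt k], that is [9 k <= 1]. *)
Lemma rate_bounds (R : realType) (s k : R) : 0 < s -> s <= 1 -> 0 <= k -> 72 * k <= 1 ->
  let r := 1 - 2^-1 * s + 3 * s * k in
  [/\ 0 <= r, 3 / 8 * s <= 1 - r &
      r <= 1 - s / 2 * Num.max (3 / 4) (1 - 2 * Num.sqrt k)].
Proof.
move=> s0 s1 k0 k72 r; have sk : 72 * (s * k) <= s by nra.
have sk0 : 0 <= s * k by rewrite mulr_ge0 // ltW.
split; rewrite ?/r; [lra|lra|].
have [_|_] := leP (3 / 4) (1 - 2 * Num.sqrt k); last by lra.
set v := Num.sqrt k; have v0 : 0 <= v := sqrtr_ge0 k.
have vk : v ^+ 2 = k by rewrite sqr_sqrtr.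
have v3 : 3 * v <= 1.
  by rewrite -(@ler_pXn2r _ 2) ?nnegrE ?mulr_ge0 // expr1n exprMn vk; lra.
have : s * (3 * v * v) <= s * v by rewrite ler_pM2l // ler_piMl.
by rewrite -vk; lra.
Qed.

Lemma rate_expR (R : realType) (r x : R) T : 0 <= r -> r <= 1 - x ->
  r ^+ T <= expR (- (x * T%:R)).
Proof.
move=> r0 rx; rewrite -mulNr expRM_natr.
rewrite lerXn2r ?nnegrE ?expR_ge0 //.
by apply: le_trans (expR_ge1Dx _); lra.
Qed.

(** * Stochastic heavy ball on the quadratic finite sum *)

Section HeavyBall.
Context (R : realType) (d n b : nat) (A : 'I_n -> 'M[R]_d) (c : 'I_n -> 'cV[R]_d)
  (L a : R) (wstar : 'cV[R]_d).

Let f i : 'cV[R]_d -> R := quad_fun (A i) (c i).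
Let Abar : 'M[R]_d := n%:R^-1 *: \sum_(i < n) A i.
Let mu : R := lambda_min Abar.
Let zeta : R := Num.sqrt (3 * ((n%:R - b%:R) / ((n%:R - 1) * b%:R))).
Let chi : R := Num.sqrt (n%:R^-1 * \sum_i enorm (gradient (f i) wstar) ^+ 2).
Let alpha : R := a / L.
Let s : R := Num.sqrt (alpha * mu).
Let beta : R := (1 - 2^-1 * s) ^+ 2.

Definition hb_step (S : {set 'I_n}) (z : 'cV[R]_d * 'cV[R]_d) : 'cV[R]_d * 'cV[R]_d :=
  (z.1 - alpha *: batch_gradient b f S z.1 + beta *: (z.1 - z.2), z.1).

Lemma heavy_ball_pair_chain (disp : measure_display) (Omega : measurableType disp)
  (B : nat -> Omega -> {set 'I_n}) w0 k omega :
  heavy_ball_pair (fun k => batch_gradient b f (B k omega)) alpha beta w0 k =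
  chain B hb_step (w0, w0) k omega.
Proof. by elim: k => //= k ->. Qed.

Hypotheses (n2 : (2 <= n)%N) (bn : (b <= n)%N) (b0 : (0 < b)%N)
  (pA : forall i, sym_psd (A i)) (a0 : 0 < a) (a1 : a <= 1) (L0 : 0 < L)
  (AL : forall i x, dot x (A i *m x) <= L * dot x x) (mu0 : 0 < mu)
  (Awstar : Abar *m wstar = n%:R^-1 *: \sum_(i < n) c i).

Let n_gt0 : 0 < n%:R :> R. Proof. by rewrite ltr0n (ltn_trans _ n2). Qed.

Lemma mean_mulmx (x : 'cV[R]_d) : Abar *m x = n%:R^-1 *: \sum_i A i *m x.
Proof. by rewrite -scalemxAl mulmx_suml. Qed.

Lemma mean_quad (x : 'cV[R]_d) : dot x (Abar *m x) = n%:R^-1 * \sum_i dot x (A i *m x).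
Proof.
rewrite mean_mulmx dotZr dotC dot_suml; congr (_ * _).
by apply: eq_bigr => i _; rewrite dotC.
Qed.

Lemma mean_sym_psd : sym_psd Abar.
Proof.
apply/sym_psdP; split=> [|x].
  rewrite linearZ /= linear_sum; congr (_ *: _).
  by apply: eq_bigr => i _; case: (pA i).
rewrite mean_quad mulr_ge0 ?invr_ge0 ?ler0n // sumr_ge0 // => i _.
by case: (sym_psdP (A i)).1.
Qed.

Lemma mean_quad_le (x : 'cV[R]_d) : dot x (Abar *m x) <= L * dot x x.
Proof.
rewrite mean_quad ler_pdivrMl //.
apply: (@le_trans _ _ (\sum_(i < n) L * dot x x)); first exact: ler_sum.
by rewrite sumr_const card_ord mulr_natl.
Qed.

Lemma mean_quad_ge (x : 'cV[R]_d) : mu * dot x x <= dot x (Abar *m x).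
Proof. by apply: lambda_min_le; case: mean_sym_psd. Qed.

(** Both constants bound the Rayleigh quotient of [Abar] at a nonzero vector, which exists since
    [mu > 0] forces [d > 0]. *)
Lemma mu_le_L : mu <= L.
Proof.
have d0 := lambda_min_gt0_dim mu0.
pose x : 'cV[R]_d := const_mx 1.
have x0 : 0 < dot x x.
  rewrite lt_neqAle dot_ge0 eq_sym dot_eq0 andbT; apply/eqP => /colP /(_ (Ordinal d0)).
  by rewrite !mxE => /eqP; rewrite oner_eq0.
by rewrite -(ler_pM2r x0) (le_trans (mean_quad_ge x)) // mean_quad_le.
Qed.

Let alpha_gt0 : 0 < alpha. Proof. by rewrite divr_gt0. Qed.
Let s_sqr : s ^+ 2 = alpha * mu. Proof. by rewrite sqr_sqrtr // mulr_ge0 ?ltW. Qed.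
Let s_gt0 : 0 < s. Proof. by rewrite sqrtr_gt0 mulr_gt0. Qed.
Let s_le1 : s <= 1.
Proof.
have s_ge0 := ltW s_gt0; rewrite -(@ler_pXn2r _ 2) ?nnegrE // expr1n s_sqr /alpha mulrAC.
rewrite ler_pdivrMr // mul1r; apply: le_trans mu_le_L.
by rewrite ler_piMl // ltW.
Qed.

Let X := alpha *: Abar.
Let symX : X^T = X.
Proof. by rewrite /X linearZ /= (proj1 mean_sym_psd). Qed.
Let X_ge (x : 'cV[R]_d) : s ^+ 2 * dot x x <= dot x (X *m x).
Proof.
by rewrite s_sqr -mulrA /X -scalemxAl dotZr ler_pM2l // mean_quad_ge.
Qed.
Let X_le (x : 'cV[R]_d) : dot (X *m x) (X *m x) <= dot x (X *m x).
Proof.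
rewrite /X -scalemxAl !dotE ler_pM2l //.
apply: (@le_trans _ _ (alpha * (L * dot x (Abar *m x)))).
  by rewrite ler_pM2l // (psd_sqr_le mean_sym_psd L0 mean_quad_le).
rewrite mulrA /alpha divfK ?gt_eqF // ler_piMl //.
exact: ((sym_psdP _).1 mean_sym_psd).2.
Qed.

Definition hb_norm (z : 'cV[R]_d * 'cV[R]_d) : R :=
  lyap_norm X s (z.1 - wstar) (z.2 - wstar).

Lemma gradientE i w : gradient (f i) w = A i *m (w - wstar) + gradient (f i) wstar.
Proof.
have sA : (A i)^T = A i by case: (pA i).
by rewrite !gradient_quad // mulmxBr addrA subrK.
Qed.

Lemma mean_gradient w : n%:R^-1 *: \sum_i gradient (f i) w = Abar *m (w - wstar).
Proof.
rewrite mulmxBr Awstar mean_mulmx -scalerBr -sumrB; congr (_ *: _).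
by apply: eq_bigr => i _; rewrite gradient_quad //; case: (pA i).
Qed.

Lemma hb_norm_step S z : hb_norm (hb_step S z) <=
  (1 - 2^-1 * s) * hb_norm z +
  alpha * enorm (batch_noise b (fun i => gradient (f i) z.1) S).
Proof.
set v := batch_noise _ _ _.
rewrite /hb_norm /hb_step /=; set x := z.1 - wstar; set y := z.2 - wstar.
have -> : z.1 - alpha *: batch_gradient b f S z.1 + beta *: (z.1 - z.2) - wstar =
    (1 + beta) *: x - X *m x - beta *: y + (- (alpha *: v)).
  have -> : batch_gradient b f S z.1 = v + Abar *m x.
    by rewrite /v /batch_noise mean_gradient subrK.
  rewrite /X -scalemxAl; move: (Abar *m x) => u.
  by apply/colP => i; rewrite !mxE; ring.
apply: (le_trans (lyap_norm_step symX s_gt0 s_le1 X_ge X_le _ _ _)).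
by rewrite enormN lerD2l !enormE !dotE mulrA sqrtrM ?sqr_ge0 // -?expr2 ?sqrtr_sqr
  ?sqr_ge0 // ger0_norm // ltW.
Qed.

Lemma batch_noise_le w :
  \sum_S draw_prob R b S * enorm (batch_noise b (fun i => gradient (f i) w) S) <=
  zeta * (L * enorm (w - wstar) + chi).
Proof.
(* The mean square of [A_i x + grad f_i (wstar)] is at most [2 L^2 |x|^2 + 2 chi^2], hence at most
   [3 (L |x| + chi)^2]; the factor 3 is the one inside [zeta]. *)
set x := w - wstar; pose K := Num.sqrt 3 * (L * enorm x + chi).
have K0 : 0 <= L * enorm x + chi.
  by rewrite addr_ge0 ?sqrtr_ge0 ?mulr_ge0 ?enorm_ge0 // ltW.
apply: (le_trans (batch_noise_mean n2 bn b0 (K := K) _ _)).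
- by rewrite mulr_ge0 ?sqrtr_ge0.
- rewrite exprMn sqr_sqrtr //.
  have chi2 : chi ^+ 2 =
      n%:R^-1 * \sum_i dot (gradient (f i) wstar) (gradient (f i) wstar).
    rewrite sqr_sqrtr.
      by congr (_ * _); apply: eq_bigr => i _; rewrite enorm_sqr.
    by rewrite mulr_ge0 ?invr_ge0 ?ler0n // sumr_ge0 // => i _; rewrite sqr_ge0.
  apply: (@le_trans _ _ (2 * L ^+ 2 * dot x x + 2 * chi ^+ 2)).
    rewrite chi2 ler_pdivrMl //; set q := dot x x.
    set G := \sum_i dot (gradient (f i) wstar) _.
    have -> : n%:R * (2 * L ^+ 2 * q + 2 * (n%:R^-1 * G)) =
        (\sum_(i < n) 2 * L ^+ 2 * q) + 2 * G.
      by rewrite sumr_const card_ord -[_ *+ n]mulr_natl; field; rewrite gt_eqF.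
    rewrite /G [X in _ + X]mulr_sumr -big_split.
    apply: ler_sum => i _ /=; rewrite gradientE -/x.
    apply: (le_trans (dotD_sqr_le _ _)); rewrite lerD2r -mulrA ler_pM2l //.
    apply: (le_trans (psd_sqr_le (pA i) L0 (AL i) x)).
    by rewrite expr2 -mulrA ler_pM2l.
  rewrite -enorm_sqr; have := mulr_ge0 (ltW L0) (enorm_ge0 x).
  have : 0 <= chi by exact: sqrtr_ge0.
  set p := L * enorm x => h1 h2; rewrite -mulrA -exprMn -/p.
  have := mulr_ge0 h1 h2; have := sqr_ge0 p; have := sqr_ge0 chi; rewrite sqrrD; lra.
- rewrite /K mulrA -sqrtrM ?[_ * 3]mulrC //.
  by rewrite divr_ge0 ?mulr_ge0 ?subr_ge0 ?ler_nat // (ler_nat R 1 n) (ltn_trans _ n2).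
Qed.

(** The noise proportional to [|x|] is absorbed into the rate through [|x| <= (3 / s) N] and
    [alpha L = a]; only the noise at [wstar] remains additive. *)
Lemma hb_drift z : transition (draw_prob R b) hb_step hb_norm z <=
  (1 - 2^-1 * s + 3 * a * zeta / s) * hb_norm z + alpha * zeta * chi.
Proof.
apply: (@le_trans _ _ (\sum_S draw_prob R b S * ((1 - 2^-1 * s) * hb_norm z +
  alpha * enorm (batch_noise b (fun i => gradient (f i) z.1) S)))).
  apply: ler_sum => S _; apply: ler_wpM2l; first exact: draw_prob_ge0.
  exact: hb_norm_step.
under eq_bigr do rewrite mulrDr [_ * (alpha * _)]mulrCA.
rewrite big_split -mulr_suml sum_draw_prob // mul1r -mulr_sumr /=.
set r := 1 - _; rewrite [in leRHS]mulrDl -addrA lerD2l.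
apply: (@le_trans _ _ (alpha * (zeta * (L * (3 / s * hb_norm z) + chi)))).
  rewrite ler_pM2l //; apply: (le_trans (batch_noise_le _)).
  rewrite ler_wpM2l ?sqrtr_ge0 // lerD2r ler_pM2l //.
  exact: (enorm_le_lyap s_gt0 s_le1 X_ge X_le).
rewrite le_eqVlt; apply/orP; left; apply/eqP; rewrite /alpha; field.
by rewrite !gt_eqF.
Qed.

Lemma enorm_le_hb_norm z : enorm (z.1 - wstar) <= 3 / s * hb_norm z.
Proof. exact: (enorm_le_lyap s_gt0 s_le1 X_ge X_le). Qed.

Lemma hb_norm_start w0 : hb_norm (w0, w0) <= enorm (w0 - wstar).
Proof.
by rewrite /hb_norm /lyap_norm enormE ler_sqrt ?dot_ge0 //; exact: lyap_diag X_le _.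
Qed.

Lemma hb_bound (w0 : 'cV[R]_d) T : 72 * (L / mu * zeta) <= 1 ->
  iter T (transition (draw_prob R b) hb_step) (fun z => enorm (z.1 - wstar)) (w0, w0) <=
  3 / s * expR (- (s / 2 * Num.max (3 / 4) (1 - 2 * Num.sqrt (L / mu * zeta)) * T%:R))
    * enorm (w0 - wstar) + 8 * zeta * chi / mu.
Proof.
move=> k72; set k := L / mu * zeta; set x0 := enorm _.
have zeta0 : 0 <= zeta by exact: sqrtr_ge0.
have chi0 : 0 <= chi by exact: sqrtr_ge0.
have k0 : 0 <= k by rewrite mulr_ge0 // divr_ge0 ?ltW.
have s30 : 0 < 3 / s by rewrite divr_gt0.
have mu_neq0 : mu != 0 by rewrite gt_eqF.
have L_neq0 : L != 0 by rewrite gt_eqF.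
have s_neq0 : s != 0 by rewrite gt_eqF.
have [r0 r1 rexp] := rate_bounds s_gt0 s_le1 k0 k72; set r := 1 - _ + _ in r0 r1 rexp.
(* This turns the excess [3 a zeta / s] of the rate into [3 s k], the form used by [rate_bounds]. *)
have aE : a = s ^+ 2 * L / mu by rewrite s_sqr /alpha; field; rewrite mu_neq0 L_neq0.
have drift z : transition (draw_prob R b) hb_step (fun z => 3 / s * hb_norm z) z <=
    r * (3 / s * hb_norm z) + 3 / s * (alpha * zeta * chi).
  rewrite /transition; under eq_bigr do rewrite mulrCA.
  rewrite -mulr_sumr mulrCA -mulrDr ler_pM2l //.
  apply: (le_trans (hb_drift z)); rewrite lerD2r.
  rewrite le_eqVlt; apply/orP; left; apply/eqP; congr (_ * _).
  by rewrite /r /k [in LHS]aE; field; rewrite mu_neq0 s_neq0.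
have r_lt1 : r < 1 by have := s_gt0; lra.
apply: (le_trans (iter_transition_mono _ _ _ (draw_prob_ge0 _ _) enorm_le_hb_norm)).
apply: (le_trans (iter_transition_le _ _ (draw_prob_ge0 _ _) (sum_draw_prob R bn)
  r0 r_lt1 drift)).
apply: lerD.
  rewrite mulrCA -mulrA ler_pM2l //; apply: ler_pM.
  - exact: exprn_ge0.
  - exact: sqrtr_ge0.
  - exact: rate_expR.
  - exact: hb_norm_start.
have e0 : 0 <= 3 / s * (alpha * zeta * chi).
  apply: mulr_ge0; first exact: ltW.
  by apply: mulr_ge0 => //; apply: mulr_ge0 => //; exact: ltW.
(* As [1 - r >= 3 s / 8] and [s^2 = alpha mu], the accumulated noise is at most
   [8 alpha zeta chi / s^2 = 8 zeta chi / mu]. *)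
apply: (@le_trans _ _ (3 / s * (alpha * zeta * chi) / (3 / 8 * s))).
  apply: ler_pM.
  - by apply: mulr_ge0 => //; rewrite subr_ge0 exprn_ile1 // ltW.
  - by rewrite invr_ge0 subr_ge0 ltW.
  - by rewrite ler_piMr // gerBl exprn_ge0.
  - by rewrite lef_pV2 ?posrE ?subr_gt0 ?mulr_gt0.
rewrite le_eqVlt; apply/orP; left; apply/eqP.
rewrite /alpha aE; field.
by rewrite mu_neq0 L_neq0 s_neq0.
Qed.

End HeavyBall.

(* The constant comes from [3 / (3 ^ 5 * 2 ^ 6) = 1 / 72 ^ 2]. *)
Lemma batch_size_bounds (R : realType) (n b : nat) (a k : R) : (2 <= n)%N ->
  0 < a -> 0 < k ->
  n%:R * Num.max (1 / (1 + (n%:R - 1) / (3 ^+ 5 * 2 ^+ 6 * k ^+ 2)))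
                 (1 / (1 + (n%:R - 1) * a / 3)) <= b%:R ->
  let zeta := Num.sqrt (3 * ((n%:R - b%:R) / ((n%:R - 1) * b%:R))) in
  [/\ (0 < b)%N, 72 * (k * zeta) <= 1 & zeta <= Num.sqrt a].
Proof.
move=> n2 a0 k0 hb zeta; have n0 : 0 < n%:R :> R by rewrite ltr0n (ltn_trans _ n2).
have n1 : 0 < n%:R - 1 :> R by rewrite subr_gt0 (ltr_nat R 1 n).
(* [n / (1 + (n - 1) x) <= b] rearranges to [(n - b) / ((n - 1) b) <= x]; the two thresholds are
   [x = 1 / (C kappa^2)] and [x = a / 3]. *)
have bound (x : R) : 0 <= x -> n%:R * (1 / (1 + (n%:R - 1) * x)) <= b%:R ->
    0 < b%:R :> R /\ 3 * ((n%:R - b%:R) / ((n%:R - 1) * b%:R)) <= 3 * x.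
  move=> x0; have y0 : 0 < 1 + (n%:R - 1) * x :> R.
    by rewrite ltr_pwDl // mulr_ge0 // ltW.
  rewrite div1r ler_pdivrMr // => h.
  have b0 : 0 < b%:R :> R by rewrite -(pmulr_lgt0 _ y0) (lt_le_trans n0).
  split=> //; rewrite ler_pM2l // ler_pdivrMr ?mulr_gt0 //; lra.
move: hb; rewrite (maxr_pMr _ _ (ltW n0)) ge_max => /andP[hb1 hb2].
have K0 : 0 < 3 ^+ 5 * 2 ^+ 6 * k ^+ 2 :> R by rewrite !mulr_gt0 ?exprn_gt0.
have [|b0 z1] := bound (3 ^+ 5 * 2 ^+ 6 * k ^+ 2)^-1 _ hb1.
  by rewrite invr_ge0 ltW.
have [||_ z2] := bound (a / 3).
- by rewrite divr_ge0 // ltW.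
- by rewrite [X in 1 + X]mulrA.
split; first by rewrite ltr0n in b0.
- rewrite mulrA -ler_pdivlMl ?mulr_gt0 // mulr1.
  have -> : (72 * k)^-1 = Num.sqrt ((72 * k)^-1 ^+ 2).
    by rewrite sqrtr_sqr ger0_norm // invr_ge0 mulr_ge0 // ltW.
  apply: ler_wsqrtr; apply: (le_trans z1).
  by rewrite le_eqVlt; apply/orP; left; apply/eqP; field; rewrite gt_eqF.
- by apply: ler_wsqrtr; apply: (le_trans z2); rewrite mulrCA divff ?mulr1.
Qed.

(** * Convergence in expectation under the batch-size condition *)

Theorem theorem2 (R : realType) (d n : nat)
  (A : 'I_n -> 'M[R]_d) (c : 'I_n -> 'cV[R]_d)
  (disp : measure_display) (Omega : measurableType disp)
  (P : probability Omega R) (b : nat) (B : nat -> Omega -> {set 'I_n})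
  (a : R) (w0 wstar : 'cV[R]_d) :
  let f (i : 'I_n) : 'cV[R]_d -> R := quad_fun (A i) (c i) in
  let F (w : 'cV[R]_d) : R := n%:R^-1 * \sum_(i < n) f i w in
  let L : R := smoothness A in
  let mu : R := lambda_min (n%:R^-1 *: \sum_(i < n) A i) in
  let kappa : R := L / mu in
  let alpha : R := a / L in
  let beta : R := (1 - 2^-1 * Num.sqrt (alpha * mu)) ^+ 2 in
  let C : R := 3 ^+ 5 * 2 ^+ 6 in
  let bstar : R :=
    n%:R * Num.max (1 / (1 + (n%:R - 1) / (C * kappa ^+ 2)))
                   (1 / (1 + (n%:R - 1) * a / 3)) in
  let zeta : R := Num.sqrt (3 * ((n%:R - b%:R) / ((n%:R - 1) * b%:R))) in
  let chi : R :=
    Num.sqrt (n%:R^-1 * \sum_(i < n) enorm (gradient (f i) wstar) ^+ 2) in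
  let w (T : nat) (omega : Omega) : 'cV[R]_d :=
    heavy_ball (fun k => batch_gradient b f (B k omega)) alpha beta w0 T in
  (2 <= n)%N ->
  (forall i, sym_psd (A i)) ->
  (forall i, bounded_below (f i)) ->
  0 < mu ->
  (forall v, F wstar <= F v) ->
  0 < a -> a <= 1 ->
  (b <= n)%N -> bstar <= b%:R ->
  (forall k, uniform_batch P b (B k)) ->
  mutually_independent P B ->
  forall T : nat, (1 <= T)%N ->
    ('E_P[fun omega => enorm (w T omega - wstar)] <=
     (6 * Num.sqrt 2 * Num.sqrt kappa / Num.sqrt a
        * expR (- (Num.sqrt a * T%:R / (2 * Num.sqrt kappa)
                   * Num.max (3 / 4) (1 - 2 * Num.sqrt kappa * Num.sqrt zeta)))
        * enorm (w0 - wstar)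
      + 12 * Num.sqrt a * chi / mu * Num.min 1 (zeta / Num.sqrt a))%:E)%E.
Proof.
move=> f F L mu kappa alpha beta C bstar zeta chi w n2 pA _ mu0 wmin a0 a1 bn hb
  unifB indB T _.
have AL i x : dot x (A i *m x) <= L * dot x x.
  have [sA _] := pA i; apply: (le_trans (le_lambda_max x sA)).
  by rewrite ler_wpM2r ?dot_ge0 // /L /smoothness le_bigmax.
have muL : mu <= L := mu_le_L n2 pA AL mu0.
have L0 : 0 < L := lt_le_trans mu0 muL.
have kappa0 : 0 < kappa by rewrite divr_gt0.
have [b0 k72 zeta_a] := batch_size_bounds n2 a0 kappa0 hb.
have zeta0 : 0 <= zeta by exact: sqrtr_ge0.
(* [F] is the quadratic with averaged coefficients, so minimality of [wstar] becomes a linear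
   equation. *)
have Awstar : (n%:R^-1 *: \sum_(i < n) A i) *m wstar = n%:R^-1 *: \sum_(i < n) c i.
  apply: quad_argmin; first exact: mean_sym_psd.
  have FE v : F v =
      quad_fun (n%:R^-1 *: \sum_(i < n) A i) (n%:R^-1 *: \sum_(i < n) c i) v.
    rewrite quad_funE mean_quad dotZl dot_suml mulrCA -mulrBr mulr_sumr -sumrB.
    by congr (_ * _); apply: eq_bigr => i _; rewrite /f quad_funE.
  by move=> v; rewrite -!FE.
pose h (z : 'cV[R]_d * 'cV[R]_d) := enorm (z.1 - wstar).
(* Once the iterates are written as a chain, the expectation is an iterate of the transition
   operator, with no probability space left. *)
have wE : (fun omega => enorm (w T omega - wstar)) =
    h \o chain B (hb_step b A c L a) (w0, w0) T.
  by apply/funext => omega; rewrite /= -heavy_ball_pair_chain.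
have h0 z : 0 <= h z by exact: enorm_ge0.
rewrite wE (expectation_chain _ _ unifB indB _ h0) lee_fin.
apply: (le_trans (hb_bound n2 bn b0 pA a0 a1 L0 AL mu0 Awstar w0 T k72)).
rewrite -/mu -/zeta -/kappa -/chi -/alpha.
set q := Num.sqrt kappa; set rho := Num.sqrt a.
have q0 : 0 < q by rewrite sqrtr_gt0.
have rho0 : 0 < rho by rewrite sqrtr_gt0.
have -> : Num.sqrt (alpha * mu) = rho / q.
  rewrite -sqrtrV ?ltW // -sqrtrM ?ltW //; congr Num.sqrt.
  by rewrite /alpha /kappa; field; rewrite !gt_eqF.
rewrite (sqrtrM _ (ltW kappa0)) -/q.
apply: lerD.
  rewrite ler_wpM2r ?enorm_ge0 //.
  rewrite (_ : rho / q / 2 * _ * _ = rho * T%:R / (2 * q) *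
    Num.max (3 / 4) (1 - 2 * q * Num.sqrt zeta)); last first.
    by rewrite [2 * (q * _)]mulrA; field; rewrite gt_eqF.
  (* With [s = rho / q] the prefactor is [3 q / rho], and [3 <= 6 sqrt 2]. *)
  rewrite ler_wpM2r ?expR_ge0 // invf_div mulrA ler_pM2r ?invr_gt0 // ler_pM2r //.
  have : 1 <= Num.sqrt 2 :> R by rewrite -[leLHS]sqrtr1 ler_wsqrtr // (ler_nat R 1 2).
  lra.
(* The second batch-size threshold gives [zeta <= rho]; the noise terms then compare by
   [8 <= 12]. *)
have -> : Num.min 1 (zeta / rho) = zeta / rho.
  by apply/min_idPr; rewrite ler_pdivrMr // mul1r.
rewrite (_ : 12 * rho * chi / mu * (zeta / rho) = 12 * zeta * chi / mu); last first.
  by field; rewrite !gt_eqF.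
rewrite ler_pM2r ?invr_gt0 // ler_wpM2r ?sqrtr_ge0 // ler_wpM2r //; lra.
Qed.
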